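(* Let $n\ge 1$. (i) Let $f:\mathbb{R}^n\to\mathbb{R}\cup\{+\infty\}$ be proper and lower semicontinuous, with $\mathrm{dom}(f):=\{x\in\mathbb{R}^n\mid f(x)\in\mathbb{R}\}$ closed. Then there exist $C^\infty$ functions $P,Q:\mathbb{R}^n\times\mathbb{R}^3\to\mathbb{R}$ such that, with lower-level feasible set $\mathcal{Y}=\mathbb{R}^3$, the optimistic value function satisfies $\varphi_o(x)=f(x)$ for all $x\in\mathbb{R}^n$. (ii) Let $f:\mathbb{R}^n\to\mathbb{R}\cup\{-\infty\}$ be proper and upper semicontinuous, with $\mathrm{dom}(f):=\{x\in\mathbb{R}^n\mid f(x)\in\mathbb{R}\}$ closed. Then there exist $C^\infty$ functions $P,Q:\mathbb{R}^n\times\mathbb{R}^3\to\mathbb{R}$ such that, with $\mathcal{Y}=\mathbb{R}^3$, the pessimistic value function satisfies $\varphi_p(x)=f(x)$ for all $x\in\mathbb{R}^n$.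
   Context: Bilevel problem data: functions $P,Q:\mathbb{R}^n\times\mathbb{R}^m\to\mathbb{R}$ (upper- and lower-level objectives) and a set $\mathcal{Y}\subseteq\mathbb{R}^m$. For $x\in\mathbb{R}^n$ let $\Theta(x):=\arg\min_{y\in\mathcal{Y}}Q(x,y)$. The optimistic value function is $\varphi_o(x)=\inf_{y\in\Theta(x)}P(x,y)$ and the pessimistic value function is $\varphi_p(x)=\sup_{y\in\Theta(x)}P(x,y)$, with the conventions $\varphi_o(x)=+\infty$ and $\varphi_p(x)=-\infty$ when $\Theta(x)=\emptyset$. *)

(* Defs.v *)
From mathcomp Require Import all_boot all_order all_algebra.
From mathcomp Require Import all_classical all_reals all_analysis.

Set Implicit Arguments.
Unset Strict Implicit.
Unset Printing Implicit Defensive.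

Import Order.TTheory GRing.Theory Num.Theory.
Import numFieldNormedType.Exports.

Local Open Scope classical_set_scope.
Local Open Scope ring_scope.

(* C^k is meant for finite-dimensional V, where continuity of x |-> 'd f x is
   the same as continuity of x |-> 'd f x v = 'D_v f x for every v (and
   likewise for higher regularity), and where all norms are equivalent. *)
Fixpoint Ck (R : realType) (V : normedModType R) (k : nat) (f : V -> R) : Prop :=
  if k is k'.+1 then
    (forall x, differentiable f x) /\ (forall v, Ck k' ('D_v f))
  else continuous f.

Definition smooth (R : realType) (V : normedModType R) (f : V -> R) : Prop :=
  forall k, Ck k f.

(* Dual of the library's lower_semicontinuous. *)
Definition upper_semicontinuous (R : realType) (X : topologicalType)
    (f : X -> \bar R) : Prop :=
  forall x a, (f x < a%:E)%E -> exists2 V, nbhs x V & forall y, V y -> (f y < a%:E)%E.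

Definition edom (R : realType) (X : Type) (f : X -> \bar R) : set X :=
  [set x | f x \is a fin_num].

(* For functions into R U {+oo}, resp. R U {-oo}: properness is non-emptiness
   of the set of points with a finite value. *)
Definition proper_above (R : realType) (X : Type) (f : X -> \bar R) : Prop :=
  (forall x, f x != -oo%E) /\ edom f !=set0.

Definition proper_below (R : realType) (X : Type) (f : X -> \bar R) : Prop :=
  (forall x, f x != +oo%E) /\ edom f !=set0.

Definition argmin (R : realType) (T : Type) (Y : set T) (g : T -> R) : set T :=
  [set y | Y y /\ forall z, Y z -> g y <= g z].

Definition Theta (R : realType) (n m : nat) (Q : 'rV[R]_n * 'rV[R]_m -> R)
    (Y : set 'rV[R]_m) (x : 'rV[R]_n) : set 'rV[R]_m :=
  argmin Y (fun y => Q (x, y)).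

(* ereal_inf set0 = +oo and ereal_sup set0 = -oo, as the conventions for an
   empty Theta Q Y x require. *)
Definition phi_opt (R : realType) (n m : nat) (P Q : 'rV[R]_n * 'rV[R]_m -> R)
    (Y : set 'rV[R]_m) (x : 'rV[R]_n) : \bar R :=
  ereal_inf [set (P (x, y))%:E | y in Theta Q Y x].

Definition phi_pes (R : realType) (n m : nat) (P Q : 'rV[R]_n * 'rV[R]_m -> R)
    (Y : set 'rV[R]_m) (x : 'rV[R]_n) : \bar R :=
  ereal_sup [set (P (x, y))%:E | y in Theta Q Y x].

(* Main.v *)
Require Import Defs.
From HB Require Import structures.
From mathcomp Require Import all_boot all_order all_algebra.
From mathcomp Require Import all_classical all_reals all_analysis.
From mathcomp Require Import ring lra.

(** The epigraph [{(x, t) | f x <= t}] of a lower semicontinuous [f] is closed,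
    so there is a smooth [g >= 0] vanishing exactly on it.  Take [P(x, y) = y_0]
    and [Q(x, y) = g(x, y_0) exp(y_1)].  If [f x] is finite, the minimizers of
    [Q(x, .)] are the [y] with [f x <= y_0], and the infimum of [P] over them is
    [f x].  If [f x = +oo], then [g(x, .) > 0] and [Q(x, .)] can always be
    decreased by lowering [y_1], so there is no minimizer.  Part (ii) is part (i)
    for [-f], with [P] replaced by [-P].

    The function [g] is a sum of rescaled bumps [c_i b(r_i (z - a_i))] over the
    countably many rational cubes contained in the complement of the epigraph.
    All derivatives of [b] are bounded and Lipschitz, and [c_i] decays faster
    than every power of [r_i], so the series can be differentiated term by term
    and its derivatives are again series of the same shape. *)

Set Implicit Arguments.
Unset Strict Implicit.
Unset Printing Implicit Defensive.

Import Order.TTheory GRing.Theory Num.Theory.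
Import numFieldNormedType.Exports.

Local Open Scope classical_set_scope.
Local Open Scope ring_scope.

(** * Closure properties of $C^k$ functions *)

Section Smoothness.
Context {R : realType} {V : normedModType R}.
Implicit Types (f g : V -> R) (k : nat).

Lemma differentiable_fun_continuous f : (forall x, differentiable f x) -> continuous f.
Proof. by move=> df x; exact: differentiable_continuous. Qed.

Lemma Ck_continuous k f : Ck k f -> continuous f.
Proof. by case: k => [//|k] [/differentiable_fun_continuous]. Qed.

Lemma CkW k f : Ck k.+1 f -> Ck k f.
Proof.
elim: k f => [|k IH] f; first exact: Ck_continuous.
by move=> [df Df]; split=> // v; apply: IH.
Qed.

Lemma derive_fun_cst (c : R) v : 'D_v (cst c : V -> R) = cst 0.
Proof. by apply/funext => x; rewrite derive_cst. Qed.

Lemma derive_funD f g v : (forall x, differentiable f x) ->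
  (forall x, differentiable g x) -> 'D_v (f + g) = 'D_v f + 'D_v g.
Proof. by move=> df dg; apply/funext => x; rewrite deriveD//; exact: diff_derivable. Qed.

Lemma derive_funM f g v : (forall x, differentiable f x) ->
  (forall x, differentiable g x) -> 'D_v (f * g) = f * 'D_v g + g * 'D_v f.
Proof. by move=> df dg; apply/funext => x; rewrite deriveM//; exact: diff_derivable. Qed.

Lemma Ck_cst k (c : R) : Ck k (cst c : V -> R).
Proof.
elim: k c => [|k IH] c; first exact: cst_continuous.
by split=> [x|v]; [exact: differentiable_cst|rewrite derive_fun_cst].
Qed.

Lemma CkD k f g : Ck k f -> Ck k g -> Ck k (f + g).
Proof.
elim: k f g => [|k IH] f g; first by move=> cf cg x; exact: (continuousD (cf x) (cg x)).
move=> [df Df] [dg Dg]; split=> [x|v]; first exact: differentiableD.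
by rewrite derive_funD//; apply: IH; [exact: Df|exact: Dg].
Qed.

Lemma CkM k f g : Ck k f -> Ck k g -> Ck k (f * g).
Proof.
elim: k f g => [|k IH] f g; first by move=> cf cg x; exact: (continuousM (cf x) (cg x)).
move=> [df Df] [dg Dg]; split=> [x|v]; first exact: differentiableM.
rewrite derive_funM//; apply: CkD; apply: IH.
- exact: (@CkW k f).
- exact: Dg.
- exact: (@CkW k g).
- exact: Df.
Qed.

Lemma CkZ k f (c : R) : Ck k f -> Ck k (c *: f).
Proof. exact: (@CkM k (cst c) f (Ck_cst k c)). Qed.

Lemma Ck_linear k (l : {linear V -> R}) : continuous l -> Ck k l.
Proof.
move=> cl; case: k => [//|k]; split=> [x|v]; first exact: linear_differentiable.
rewrite (_ : 'D_v l = cst (l v)); first exact: Ck_cst.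
by apply/funext => x; rewrite deriveE ?diff_lin//; exact: linear_differentiable.
Qed.

Lemma is_diff_comp_affine (h : R -> R) (l : {linear V -> R}) (d h' : R) x :
  continuous l -> is_derive (l x + d) 1 h h' ->
  is_diff x (fun z => h (l z + d)) (fun v => h' * l v).
Proof.
move=> cl hh'.
have dl : is_diff x (fun z => l z + d) l.
  have -> : (fun z => l z + d) = (l : V -> R) + cst d by [].
  have dl0 : is_diff x l l.
    by apply: DiffDef; [exact: linear_differentiable|exact: diff_lin].
  by apply: (is_diff_eq (is_diffD dl0 (is_diff_cst d x))); rewrite addr0.
have dh : is_diff (l x + d) h (fun t => h' * t).
  have [dh eh] := hh'; apply: DiffDef; first exact/derivable1_diffP.
  by apply/funext => t; rewrite deriv1E//= derive1E eh; apply: mulrC.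
by have := @is_diff_comp _ _ _ _ _ _ _ _ _ dl dh.
Qed.

(** The derivative in direction [v] is [l v] times the function itself, so the induction on [k]
    closes up. *)
Lemma Ck_expR k (l : {linear V -> R}) : continuous l -> Ck k (fun x => expR (l x)).
Proof.
move=> cl; elim: k => [|k IH].
  by move=> x; apply: continuous_comp; [exact: cl|exact: continuous_expR].
have H x : is_diff x (fun z => expR (l z)) (fun v => expR (l x) * l v).
  rewrite (_ : (fun z => expR (l z)) = (fun z => expR (l z + 0))); last first.
    by apply/funext => z; rewrite addr0.
  by rewrite -[l x]addr0; apply: is_diff_comp_affine.
split=> [x|v]; first exact: ex_diff.
rewrite (_ : 'D_v _ = l v *: (fun x => expR (l x))); first exact: CkZ.
by apply/funext => x; rewrite deriveE// diff_val mulrC.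
Qed.

End Smoothness.

(** * Term-by-term differentiation of series of Lipschitz functions *)

Section SeriesDerivative.
Context {R : realType}.

(** Dominated partial sums beyond [N], passed to the limit. Keeping [c] apart from [K] allows one
    [N] to serve all increments [h], with [c] a multiple of [|h|]. *)
Lemma series_tail_le (w K : R^nat) (c : R) (N : nat) :
  cvgn (series w) -> cvgn (series K) -> (forall n, 0 <= K n) -> 0 <= c ->
  (forall n, `|w n| <= K n * c) ->
  `|limn (series w) - series w N| <= (limn (series K) - series K N) * c.
Proof.
move=> cw cK K0 c0 wK.
have cwN : `|series w n - series w N| @[n --> \oo] --> `|limn (series w) - series w N|.
  by apply: cvg_norm; apply: cvgB; [exact: cw|exact: cvg_cst].
rewrite -(cvg_lim _ cwN)//; apply: limr_le; first by apply/cvg_ex; eexists; exact: cwN.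
near=> n.
have Nn : (N <= n)%N by near: n; exists N.
rewrite sub_series_geq// (le_trans (ler_norm_sum _ _ _))//.
apply: (@le_trans _ _ (\sum_(N <= k < n) K k * c)); first by apply: ler_sum.
rewrite -mulr_suml ler_wpM2r// -sub_series_geq// lerB//.
by apply: nondecreasing_cvgn_le => //; exact: nondecreasing_series.
Unshelve. all: by end_near. Qed.

Lemma series_tail_small (K : R^nat) (e : R) : cvgn (series K) -> 0 < e ->
  exists N, limn (series K) - series K N <= e.
Proof.
move=> cK e0; have /cvgrPdist_le/(_ _ e0)[N _ NK] := cK.
by exists N; apply: (le_trans (ler_norm _)); apply: NK => /=.
Qed.

Context {V : normedModType R}.

Lemma is_diff_of_bound (f : V -> R) (df : {linear V -> R}) (x : V) :
  continuous df ->
  (forall e, 0 < e -> \forall h \near 0, `|f (h + x) - f x - df h| <= e * `|h|) ->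
  is_diff x f df.
Proof.
move=> cdf fdf.
have E : f \o shift x = cst (f x) + df +o_ (0 : V) id.
  apply/eqaddoP => e e0; near=> h.
  suff : `|f (h + x) - f x - df h| <= e * `|h| by rewrite -addrA -opprD.
  by near: h; exact: fdf.
have D := diff_unique cdf E; apply: DiffDef => //.
by apply/diff_locallyP; rewrite D.
Unshelve. all: by end_near. Qed.

Lemma differentiable_bound (f : V -> R) x : differentiable f x ->
  forall e, 0 < e -> \forall h \near 0, `|f (h + x) - f x - 'd f x h| <= e * `|h|.
Proof.
move=> /diff_locallyP[_ /eqaddoP H] e e0; have := H e e0; apply: filterS => h.
by rewrite -addrA -opprD.
Qed.

(** The difference quotients in direction [h] are bounded by [K * |h|], and the bound passes to
    their limit. *)
Lemma diff_le_lipschitz (f : V -> R) (K : R) (x : V) :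
  0 <= K -> (forall y z, `|f y - f z| <= K * `|y - z|) -> differentiable f x ->
  forall h, `|'d f x h| <= K * `|h|.
Proof.
move=> K0 fK df h.
rewrite -deriveE//; have := @diff_derivable _ _ _ f x h df => /cvg_norm c.
rewrite -(cvg_lim _ c)//; apply: limr_le; first by apply/cvg_ex; eexists; exact: c.
near=> t; rewrite normrZ normfV ler_pdivrMl ?normr_gt0//; last first.
  by near: t; exact: nbhs_dnbhs_neq.
by rewrite (le_trans (fK _ _))//= addrK normrZ mulrCA.
Unshelve. all: by end_near. Qed.

Lemma linear_bound_continuous (l : {linear V -> R}) (M : R) :
  (forall x, `|l x| <= M * `|x|) -> continuous l.
Proof.
move=> lM; apply/bounded_linear_continuous/linear_boundedP; near=> r => h.
by apply: (le_trans (lM h)); rewrite ler_wpM2r//; near: r; exact: nbhs_pinfty_ge.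
Unshelve. all: by end_near. Qed.

Context (u : nat -> V -> R) (K : R^nat).
Hypotheses (K_ge0 : forall n, 0 <= K n) (cvgK : cvgn (series K)).
Hypothesis lipu : forall n x y, `|u n x - u n y| <= K n * `|x - y|.
Hypothesis cvgu : forall x, cvgn (series (u^~ x)).
Hypothesis du : forall n x, differentiable (u n) x.

Let du_le n x h : `|'d (u n) x h| <= K n * `|h|.
Proof. by apply: diff_le_lipschitz. Qed.

Let cvg_dom (w : R^nat) c : (forall n, `|w n| <= K n * c) -> cvgn (series w).
Proof.
move=> wK; apply: normed_cvg; apply: (@series_le_cvg _ _ (c *: K)) => [n|n|n|].
- exact: normr_ge0.
- by apply: le_trans (normr_ge0 (w n)) _; rewrite [leRHS]mulrC; exact: wK.
- by rewrite [leRHS]mulrC; exact: wK.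
- exact: is_cvg_seriesZ.
Qed.

Let dS x h := limn (series (fun n => 'd (u n) x h)).

Let cvg_dS x h : cvgn (series (fun n => 'd (u n) x h)).
Proof. by apply: (@cvg_dom _ `|h|) => n; exact: du_le. Qed.

Let dS_linear x : linear (dS x).
Proof.
move=> a h k; rewrite /dS.
rewrite (_ : (fun n => 'd (u n) x (a *: h + k)) =
  a *: (fun n => 'd (u n) x h) + (fun n => 'd (u n) x k)); last first.
  by apply/funext => n /=; rewrite linearP.
have ch := @cvg_dS x h; have ck := @cvg_dS x k.
rewrite lim_seriesD//; last exact: is_cvg_seriesZ.
rewrite lim_seriesZ//.
Qed.

Let dS_le x h : `|dS x h| <= limn (series K) * `|h|.
Proof.
have := @series_tail_le (fun n => 'd (u n) x h) K `|h| 0 (@cvg_dS x h) cvgK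
  K_ge0 (normr_ge0 _) (fun n => du_le n x h).
have s0 (w : R^nat) : series w 0 = 0 by rewrite /series /= big_geq.
by rewrite !s0 !subr0.
Qed.

(** The remainder of the sum is the sum of the remainders [r h n], each at most [2 * K n * |h|].
    Past a large [N] the summability of [K] makes their total small relative to [|h|], uniformly in
    [h]; the first [N] of them are a finite sum of terms [o(h)]. *)
Lemma is_diff_series x :
  is_diff x (fun y => limn (series (u^~ y)))
    (fun h => limn (series (fun n => 'd (u n) x h))).
Proof.
pose linL := GRing.isLinear.Build _ _ _ _ _ (dS_linear x).
pose L : {linear V -> R} := HB.pack (dS x) linL.
apply: (@is_diff_of_bound _ L); first exact: (@linear_bound_continuous L _ (dS_le x)).
move=> e e0.
(* The tail of [K] gets multiplied by 2, so [e / 4] gives the tail half of [e]; the finite part gets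
   the other half. *)
have e40 : 0 < e / 4 by rewrite divr_gt0.
have [N NK] := series_tail_small cvgK e40.
pose r h := (fun n => u n (h + x)) - (u^~ x) - (fun n => 'd (u n) x h).
have rK h n : `|r h n| <= K n * (2 * `|h|).
  apply: (le_trans (ler_normB _ _)).
  have := lipu n (h + x) x; rewrite addrK => H1; have H2 := du_le n x h.
  by apply: (le_trans (lerD H1 H2)); rewrite mulrCA mulr_natl mulr2n.
have part m (d : R) : 0 < d -> \forall h \near 0, `|series (r h) m| <= d * `|h|.
  elim: m d => [|m IH] d d0.
    near=> h; rewrite /series/= big_geq// normr0 mulr_ge0//; exact: ltW.
  have d20 : 0 < d / 2 by rewrite divr_gt0.
  near=> h; rewrite seriesSr (le_trans (ler_normD _ _))//.
  rewrite [leRHS](_ : _ = d / 2 * `|h| + d / 2 * `|h|); last by lra.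
  apply: lerD; first by near: h; exact: IH.
  by near: h; exact: differentiable_bound.
near=> h.
have -> : limn (series (u^~ (h + x))) - limn (series (u^~ x)) - L h = limn (series (r h)).
  have c1 := @cvgu (h + x); have c2 := @cvgu x; have c3 := @cvg_dS x h.
  rewrite /r lim_seriesB//; last exact: is_cvg_seriesB.
  by rewrite lim_seriesB.
rewrite -(subrK (series (r h) N) (limn _)) (le_trans (ler_normD _ _))//.
rewrite [leRHS](_ : _ = e / 2 * `|h| + e / 2 * `|h|); last by lra.
apply: lerD; last by near: h; apply: part; rewrite divr_gt0.
apply: le_trans (series_tail_le N _ cvgK K_ge0 _ (rK h)) _.
- by apply: cvg_dom; exact: rK.
- by rewrite mulr_ge0.
- by have := ler_wpM2r (normr_ge0 h) NK; nra.
Unshelve. all: by end_near. Qed.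

End SeriesDerivative.

(** * Functions with bounded Lipschitz derivatives, and series of their rescalings *)

Section BoundedLipschitzDerivatives.
Context {R : realType} {V : normedModType R}.
Implicit Types (f g : V -> R) (k : nat).

Definition bounded_lipschitz f : Prop := exists M,
  (forall x, `|f x| <= M) /\ (forall x y, `|f x - f y| <= M * `|x - y|).

(** A strengthening of [Ck] whose constants may depend on the directions of differentiation.
    Boundedness gives stability under products and convergence of the rescaled series; the Lipschitz
    bound gives the domination needed to differentiate them. *)
Fixpoint BLk k f : Prop := bounded_lipschitz f /\
  if k is k'.+1 then (forall x, differentiable f x) /\ (forall v, BLk k' ('D_v f))
  else True.

Lemma BLkW k f : BLk k.+1 f -> BLk k f.
Proof.
elim: k f => [|k IH] f [bf [df Df]]; first by split.
by split=> //; split=> // v; apply: IH; exact: Df.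
Qed.

Lemma bounded_lipschitzD f g :
  bounded_lipschitz f -> bounded_lipschitz g -> bounded_lipschitz (f + g).
Proof.
move=> [M [fM fL]] [N [gN gL]]; exists (M + N); split=> [x|x y].
  by rewrite (le_trans (ler_normD _ _))// lerD.
rewrite /= [X in `|X|](_ : _ = (f x - f y) + (g x - g y)); last by rewrite !fctE; ring.
by rewrite (le_trans (ler_normD _ _))// mulrDl lerD.
Qed.

Lemma bounded_lipschitzM f g :
  bounded_lipschitz f -> bounded_lipschitz g -> bounded_lipschitz (f * g).
Proof.
move=> [M [fM fL]] [N [gN gL]].
have M0 : 0 <= M := le_trans (normr_ge0 _) (fM 0).
have N0 : 0 <= N := le_trans (normr_ge0 _) (gN 0).
have MN : 0 <= M * N by exact: mulr_ge0.
exists (M * N + M * N); split=> [x|x y].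
  apply: (@le_trans _ _ (M * N)); last by rewrite lerDl.
  by rewrite normrM ler_pM.
rewrite /= [X in `|X|](_ : _ = f x * (g x - g y) + (f x - f y) * g y); last first.
  by rewrite !fctE; ring.
rewrite (le_trans (ler_normD _ _))// !normrM mulrDl lerD//.
  by rewrite -mulrA ler_pM.
by rewrite mulrAC ler_pM.
Qed.

Lemma bounded_lipschitz_cst (c : R) : bounded_lipschitz (cst c).
Proof.
by exists `|c|; split=> [x//|x y]; rewrite /= subrr normr0 mulr_ge0.
Qed.

Lemma BLk_cst k (c : R) : BLk k (cst c).
Proof.
elim: k c => [|k IH] c; first by split=> //; exact: bounded_lipschitz_cst.
split; first exact: bounded_lipschitz_cst.
by split=> [x|v]; [exact: differentiable_cst|rewrite derive_fun_cst].
Qed.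

Lemma BLkD k f g : BLk k f -> BLk k g -> BLk k (f + g).
Proof.
elim: k f g => [|k IH] f g [bf Hf] [bg Hg].
  by split=> //; exact: bounded_lipschitzD.
have [[df Df] [dg Dg]] := (Hf, Hg).
split; [exact: bounded_lipschitzD|split=> [x|v]; first exact: differentiableD].
by rewrite derive_funD//; apply: IH; [exact: Df|exact: Dg].
Qed.

Lemma BLkM k f g : BLk k f -> BLk k g -> BLk k (f * g).
Proof.
elim: k f g => [|k IH] f g.
  by move=> [bf _] [bg _]; split=> //; exact: bounded_lipschitzM.
move=> Bf Bg; have [[bf [df Df]] [bg [dg Dg]]] := (Bf, Bg).
split; [exact: bounded_lipschitzM|split=> [x|v]; first exact: differentiableM].
rewrite derive_funM//.
by apply: BLkD; apply: IH; [exact: BLkW|exact: Dg|exact: BLkW|exact: Df].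
Qed.

Lemma BLkZ k f (c : R) : BLk k f -> BLk k (c *: f).
Proof. exact: (@BLkM k (cst c) f (BLk_cst k c)). Qed.

Lemma BLk_prod k n (F : 'I_n -> V -> R) :
  (forall i, BLk k (F i)) -> BLk k (fun x => \prod_(i < n) F i x).
Proof.
elim: n F => [|n IH] F HF.
  rewrite (_ : (fun _ => _) = cst 1); first exact: BLk_cst.
  by apply/funext => x; rewrite big_ord0.
rewrite (_ : (fun _ => _) =
    (fun x => \prod_(i < n) F (widen_ord (leqnSn n) i) x) * F ord_max).
  by apply: BLkM; [exact: IH|exact: HF].
by apply/funext => x; rewrite big_ord_recr.
Qed.

Lemma is_diff_comp_homothety f (r : R) (a x : V) :
  (forall y, differentiable f y) ->
  is_diff x (fun z => f (r *: (z - a))) (fun h => r *: 'd f (r *: (x - a)) h).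
Proof.
move=> df.
have dA : is_diff x (fun z => r *: (z - a)) (fun h => r *: h).
  have := is_diffZ r (is_diffB (is_diff_id x) (is_diff_cst a x)).
  by rewrite subr0.
have dF := differentiableP (df (r *: (x - a))).
apply: (is_diff_eq (@is_diff_comp _ _ _ _ _ _ _ _ _ dA dF)).
by apply/funext => h /=; rewrite linearZ.
Qed.

Section Series.
Context (g : V -> R) (c r : R^nat) (a : nat -> V).
Hypothesis BLg : forall k, BLk k g.
Hypothesis cvgc : forall j, cvgn (series (fun n => `|c n| * `|r n| ^+ j)).

Let u n z := c n * g (r n *: (z - a n)).

Lemma cvg_rescaled_series z : cvgn (series (u^~ z)).
Proof.
have [[M [gM _]] _] := BLg 0.
have M0 : 0 <= M := le_trans (normr_ge0 _) (gM 0).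
apply: normed_cvg.
apply: (@series_le_cvg _ _ (M *: (fun n => `|c n| * `|r n| ^+ 0))) => [n|n|n|].
- exact: normr_ge0.
- by rewrite mulr_ge0 ?mulr_ge0 ?exprn_ge0.
- by rewrite /= normrM [leRHS]mulrC expr0 mulr1 ler_wpM2l.
- by apply: is_cvg_seriesZ; exact: cvgc.
Qed.

(** Term [n] has Lipschitz constant [M * |c n| * |r n|], which is summable by the case [j = 1] of
    [cvgc]. The chain rule brings out a factor [r n], so the derivative is a series of the same
    shape for ['D_v g] and [c n * r n]. *)
Lemma is_diff_rescaled_series x :
  is_diff x (fun z => limn (series (u^~ z)))
    (fun v => limn (series (fun n => c n * r n * 'D_v g (r n *: (x - a n))))).
Proof.
have [[M [gM gL]] _] := BLg 0; have [_ [dg _]] := BLg 1.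
have M0 : 0 <= M := le_trans (normr_ge0 _) (gM 0).
have du n z : is_diff z (u n) (fun h => c n * (r n * 'd g (r n *: (z - a n)) h)).
  exact: (is_diffZ (c n) (is_diff_comp_homothety (r n) (a n) z dg)).
pose K := M *: (fun n => `|c n| * `|r n| ^+ 1).
have K0 n : 0 <= K n by rewrite mulr_ge0 ?mulr_ge0 ?exprn_ge0.
have cK : cvgn (series K) by apply: is_cvg_seriesZ; exact: cvgc.
have uK n y z : `|u n y - u n z| <= K n * `|y - z|.
  rewrite /u -mulrBr normrM -[leRHS]mulrA mulrCA -mulrA ler_wpM2l//.
  apply: (le_trans (gL _ _)); rewrite -scalerBr normrZ expr1.
  rewrite [X in _ <= X](_ : _ = M * (`|r n| * `|y - z|)); last by ring.
  by rewrite opprB addrA subrK.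
have dd n z : differentiable (u n) z by exact: ex_diff.
apply: is_diff_eq (is_diff_series K0 cK uK cvg_rescaled_series dd x) _.
apply/funext => v; congr (limn (series _)); apply/funext => n.
by rewrite diff_val deriveE ?mulrA.
Qed.

End Series.

(** Induction on [k] with [g] and [c] general: differentiation replaces [c n] by [c n * r n], which
    turns the summability condition for [j] into the one for [j.+1]. *)
Lemma Ck_rescaled_series k g (c r : R^nat) (a : nat -> V) :
  (forall j, BLk j g) ->
  (forall j, cvgn (series (fun n => `|c n| * `|r n| ^+ j))) ->
  Ck k (fun z => limn (series (fun n => c n * g (r n *: (z - a n))))).
Proof.
elim: k g c => [|k IH] g c BLg cvgc; have H := is_diff_rescaled_series a BLg cvgc.
  by move=> x; apply: differentiable_continuous; exact: (@ex_diff _ _ _ _ _ _ _ (H x)).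
split=> [x|v]; first exact: (@ex_diff _ _ _ _ _ _ _ (H x)).
rewrite (_ : 'D_v _ =
    fun x => limn (series (fun n => c n * r n * 'D_v g (r n *: (x - a n))))).
  apply: (IH ('D_v g) (fun n => c n * r n)) => j.
    by have [_ [_ Dg]] := BLg j.+1; exact: Dg.
  rewrite (_ : (fun n => _) = (fun n => `|c n| * `|r n| ^+ j.+1)); first exact: cvgc.
  by apply/funext => n; rewrite exprS normrM mulrA.
apply/funext => x; rewrite deriveE; last exact: (@ex_diff _ _ _ _ _ _ _ (H x)).
by rewrite (@diff_val _ _ _ _ _ _ _ (H x)).
Qed.

End BoundedLipschitzDerivatives.

(** * The flat functions $s^{-k} e^{-1/s}$ *)

Section FlatFunctions.
Context {R : realType}.

Lemma expr_le_expR (k : nat) (t : R) : 0 <= t -> t ^+ k <= k`!%:R * expR t.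
Proof.
move=> t0; case: k => [|k].
  by rewrite expr0 fact0 mul1r -expR0 ler_expR.
have F0 : 0 < k.+1`!%:R :> R by rewrite ltr0n fact_gt0.
by rewrite mulrC -ler_pdivrMr// (le_trans _ (expR_ge1Dxn k t0))// lerDr.
Qed.

(** The classical smooth function $e^{-1/s}$, extended by 0 to $s \le 0$, with an extra factor
    $s^{-k}$: with all [k] present, the linear span of the family is closed under
    differentiation. *)
Definition flat (k : nat) (s : R) : R :=
  if 0 < s then s^-1 ^+ k * expR (- s^-1) else 0.

Lemma flat_ge0 k s : 0 <= flat k s.
Proof.
by rewrite /flat; case: ifP => // s0; rewrite mulr_ge0 ?expR_ge0// exprn_ge0// invr_ge0 ltW.
Qed.

Lemma flat_gt0 k s : (0 < flat k s) = (0 < s).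
Proof.
rewrite /flat; case: ifP => [s0|]; last by rewrite ltxx.
by rewrite mulr_gt0 ?expR_gt0// exprn_gt0// invr_gt0.
Qed.

Lemma flat_le k s : flat k s <= k`!%:R.
Proof.
rewrite /flat; case: ifP => // s0.
by rewrite expRN ler_pdivrMr ?expR_gt0// expr_le_expR// invr_ge0 ltW.
Qed.

(** Used twice, this exhibits a factor $s^2$ in [flat k], hence a zero derivative at the origin. *)
Lemma flat_mul k s : flat k s = s * flat k.+1 s.
Proof.
rewrite /flat; case: ifP => [s0|]; last by rewrite mulr0.
by rewrite exprS !mulrA divff ?gt_eqF// mul1r.
Qed.

Lemma flat_le0 k s : s <= 0 -> flat k s = 0.
Proof. by rewrite /flat leNgt => /negbTE ->. Qed.

Lemma is_derive_exprV_expRNV k (s : R) : s != 0 ->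
  is_derive s 1 (fun z : R => z^-1 ^+ k * expR (- z^-1))
    (- k%:R * (s^-1 ^+ k.+1 * expR (- s^-1)) + s^-1 ^+ k.+2 * expR (- s^-1)).
Proof.
move=> s0.
have dV : is_derive s 1 (fun z : R => z^-1) (- s^-1 ^+ 2).
  apply: (is_derive_eq (@is_deriveV R (id : R -> R) s 1 1 s0 (is_derive_id s 1))).
  by rewrite /= exprVn -[LHS]/(_ * 1) mulr1.
have dE : is_derive s 1 (fun z : R => expR (- z^-1)) (expR (- s^-1) * s^-1 ^+ 2).
  apply: (is_derive_eq (is_derive1_comp (is_derive_expR _) (is_deriveN dV))).
  by rewrite opprK.
case: k => [|k].
  rewrite (_ : (fun z => _) = (fun z : R => expR (- z^-1))).
    by apply: (is_derive_eq dE); ring.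
  by apply/funext => z; rewrite expr0 mul1r.
have D := is_deriveM (is_deriveX k.+1 dV) dE.
rewrite (_ : (fun z => _) =
    (fun z : R => z^-1) ^+ k.+1 * (fun z : R => expR (- z^-1))); last first.
  by apply/funext => z; rewrite fctE exprfctE.
apply: (is_derive_eq D).
rewrite !fctE /GRing.scale /= !exprS.
move: (expR (- s^-1)) (s^-1) (k.+1%:R) => e w c; ring.
Qed.

Lemma is_derive_flat k (s : R) :
  is_derive s 1 (flat k) (- k%:R * flat k.+1 s + flat k.+2 s).
Proof.
have [s0|s0|s0] := ltgtP 0 s.
- apply: (@near_eq_is_derive R R^o R^o (fun s => s^-1 ^+ k * expR (- s^-1)) (flat k) s 1).
    by near=> z; rewrite /flat ifT//; near: z; exact: lt_nbhsr.
  by rewrite /flat s0; apply: is_derive_exprV_expRNV; rewrite gt_eqF.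
- apply: (@near_eq_is_derive R R^o R^o (cst 0) (flat k) s 1).
    by near=> z; rewrite flat_le0// ltW//; near: z; exact: lt_nbhsl.
  by rewrite !flat_le0 ?ltW// mulr0 addr0; exact: is_derive_cst.
- rewrite -s0 !flat_le0// mulr0 addr0.
  have Z : is_diff (0 : R) (flat k) (\0 : {linear R -> R}).
    apply: is_diff_of_bound => [|e e0]; first exact: cst_continuous.
    have F0 : 0 < k.+2`!%:R :> R by rewrite ltr0n fact_gt0.
    near=> h.
    have he : `|h| <= e / k.+2`!%:R.
      near: h; apply: (@nbhs0_le R R^o); exact: divr_gt0.
    rewrite addr0 (flat_le0 k (lexx _)) !subr0 flat_mul flat_mul !normrM mulrC.
    have Fh : `|flat k.+2 h| <= k.+2`!%:R by rewrite ger0_norm ?flat_ge0// flat_le.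
    rewrite ler_wpM2r// (le_trans (ler_pM (normr_ge0 h) (normr_ge0 _) he Fh))//.
    by rewrite divfK// gt_eqF.
  by apply: DeriveDef; [exact: diff_derivable|rewrite deriveE// diff_val].
Unshelve. all: by end_near. Qed.

(** The derivative combines the bounded functions [flat k.+1] and [flat k.+2], so the mean value
    theorem applies. *)
Lemma flat_lipschitz k : bounded_lipschitz (flat k).
Proof.
pose M : R := k%:R * k.+1`!%:R + k.+2`!%:R.
have M0 : 0 <= M by rewrite addr_ge0// mulr_ge0.
have dM s : `|- k%:R * flat k.+1 s + flat k.+2 s| <= M.
  rewrite (le_trans (ler_normD _ _))// normrM normrN.
  by rewrite !ger0_norm ?flat_ge0// lerD ?flat_le// ler_wpM2l ?flat_le.
(* A single constant must serve both as bound on the values ([k!]) and as Lipschitz constant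
   ([M]). *)
exists (Num.max M k`!%:R); split=> [x|x y].
  by rewrite ger0_norm ?flat_ge0// le_max flat_le orbT.
apply: (@le_trans _ _ (M * `|x - y|)); last by rewrite ler_wpM2r// le_max lexx.
wlog xy : x y / x <= y => [H|].
  have [xy|/ltW yx] := leP x y; first exact: H.
  by rewrite distrC [`|x - y|]distrC; exact: H.
have fd (z : R) : differentiable (flat k) z.
  by apply/derivable1_diffP; have [] := is_derive_flat k z.
have [|c _ E] := @MVT_segment R (flat k) _ x y xy (fun z _ => is_derive_flat k z).
  apply: continuous_subspaceT => z; exact: differentiable_continuous.
by rewrite distrC E normrM [`|x - y|]distrC ler_wpM2r.
Qed.

Lemma BLk_flat {V : normedModType R} (m k : nat) (l : {linear V -> R}) (d : R) :
  continuous l -> BLk m (fun z => flat k (l z + d)).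
Proof.
move=> cl; have [M M0 lM] := linear_lipschitz cl.
have BL k' : bounded_lipschitz (fun z => flat k' (l z + d)).
  have [N [fN fL]] := flat_lipschitz k'.
  have N0 : 0 <= N := le_trans (normr_ge0 _) (fN 0).
  exists (Num.max N (N * M)); split=> [x|x y]; first by rewrite le_max fN.
  apply: (@le_trans _ _ (N * M * `|x - y|)).
    apply: (le_trans (fL _ _)); rewrite -mulrA ler_wpM2l//.
    by rewrite opprD addrACA subrr addr0 -linearB lM.
  by rewrite ler_wpM2r// le_max lexx orbT.
elim: m k => [|m IH] k; first by split; first exact: BL.
have H x : is_diff x (fun z => flat k (l z + d))
    (fun v => (- k%:R * flat k.+1 (l x + d) + flat k.+2 (l x + d)) * l v).
  exact: (is_diff_comp_affine cl (is_derive_flat k _)).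
split; [exact: BL|split=> [x|v]; first exact: ex_diff].
rewrite (_ : 'D_v _ = l v *: ((- k%:R) *: (fun z => flat k.+1 (l z + d)) +
  (fun z => flat k.+2 (l z + d)))).
  by apply: BLkZ; apply: BLkD; [apply: BLkZ|]; exact: IH.
by apply/funext => x; rewrite deriveE// diff_val mulrC.
Qed.

End FlatFunctions.

(** * Smooth bumps positive exactly on a cube *)

Section Bump.
Context {R : realType} {n m : nat}.
Local Notation V := ('rV[R]_n * 'rV[R]_m.+1)%type.

Definition coord1 (j : 'I_n) (z : V) : R := z.1 0 j.
Definition coord2 (j : 'I_m.+1) (z : V) : R := z.2 0 j.

Lemma coord1_linear j : linear (coord1 j).
Proof. by move=> a u v; rewrite /coord1 /= !mxE. Qed.
HB.instance Definition _ j := GRing.isLinear.Build R V R *%R (coord1 j) (coord1_linear j).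

Lemma coord2_linear j : linear (coord2 j).
Proof. by move=> a u v; rewrite /coord2 /= !mxE. Qed.
HB.instance Definition _ j := GRing.isLinear.Build R V R *%R (coord2 j) (coord2_linear j).

Lemma coord1_continuous j : continuous (coord1 j).
Proof.
move=> z; apply: (@continuous_comp _ _ _ fst (fun u : 'rV[R]_n => u 0 j)).
  exact: cvg_fst.
exact: coord_continuous.
Qed.

Lemma coord2_continuous j : continuous (coord2 j).
Proof.
move=> z; apply: (@continuous_comp _ _ _ snd (fun u : 'rV[R]_m.+1 => u 0 j)).
  exact: cvg_snd.
exact: coord_continuous.
Qed.

(** On $]-1,1[$ this is $e^{-1/(1+t)} e^{-1/(1-t)}$, and it vanishes elsewhere: a smooth bump. *)
Definition tent (t : R) : R := flat 0 (t + 1) * flat 0 (- t + 1).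

Lemma tent_ge0 t : 0 <= tent t.
Proof. by rewrite mulr_ge0// flat_ge0. Qed.

Lemma tent_gt0 t : (0 < tent t) = (`|t| < 1).
Proof.
rewrite ltr_norml -[-1 < t]subr_gt0 opprK -[t < 1]subr_gt0 [1 - t]addrC.
rewrite -(flat_gt0 0 (t + 1)) -(flat_gt0 0 (- t + 1)) /tent.
have [a b] := (flat_ge0 0 (t + 1), flat_ge0 0 (- t + 1)).
by rewrite !lt_def mulf_eq0 negb_or a b mulr_ge0// !andbT.
Qed.

Lemma BLk_tent k (l : {linear V -> R}) : continuous l -> BLk k (fun z => tent (l z)).
Proof.
move=> cl; apply: (@BLkM _ _ k (fun z => flat 0 (l z + 1)) (fun z => flat 0 (- l z + 1))).
  exact: BLk_flat.
apply: (@BLk_flat _ _ k 0 (\- l : {linear V -> R})) => z.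
exact: (@continuousN _ _ _ l z (cl z)).
Qed.

(** Positive on a cylinder over a cube in the variables $(x, y_0)$, so that sums of rescaled bumps
    are constant in the other coordinates of $y$. *)
Definition bump (z : V) : R := tent (coord2 ord0 z) * \prod_(j < n) tent (coord1 j z).

Lemma BLk_bump k : BLk k bump.
Proof.
apply: (@BLkM _ _ k (fun z => tent (coord2 ord0 z))
  (fun z => \prod_(j < n) tent (coord1 j z))).
  by apply: BLk_tent; exact: coord2_continuous.
by apply: BLk_prod => j; apply: BLk_tent; exact: coord1_continuous.
Qed.

Lemma bump_ge0 z : 0 <= bump z.
Proof. by rewrite mulr_ge0 ?tent_ge0// prodr_ge0// => j _; exact: tent_ge0. Qed.

Lemma bump_gt0 z :
  0 < bump z <-> `|z.2 0 ord0| < 1 /\ forall j, `|z.1 0 j| < 1.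
Proof.
rewrite lt_def bump_ge0 andbT mulf_eq0 negb_or; split.
  move=> /andP[h2 /prodf_neq0 h1]; split=> [|j]; rewrite -tent_gt0 lt_def tent_ge0 andbT//.
  exact: h1.
move=> [h2 h1]; apply/andP; split; first by rewrite gt_eqF// tent_gt0.
by apply/prodf_neq0 => j _; rewrite gt_eqF// tent_gt0; exact: h1.
Qed.

End Bump.

(** * A smooth function positive exactly on the strict hypograph *)

Section Hypograph.
Context {R : realType} {n : nat}.
Variable f : 'rV[R]_n -> \bar R.
Local Notation V := ('rV[R]_n * 'rV[R]_3)%type.

(* (q, s, m) encodes the open cube of radius 1 / (m + 1) centred at (q, s). *)
Local Notation cube := ('rV[rat]_n * rat * nat)%type.

(** The inequalities are kept in rescaled form, to match [bump_gt0] at a rescaled point. *)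
Definition in_cube (p : cube) (x : 'rV[R]_n) (t : R) : Prop :=
  `|p.2.+1%:R * (t - ratr p.1.2)| < 1 /\
  forall j, `|p.2.+1%:R * (x 0 j - ratr (p.1.1 0 j))| < 1.

Definition below_graph (p : cube) : Prop := forall x t, in_cube p x t -> (t%:E < f x)%E.

Lemma rat_approx (x e : R) : 0 < e -> exists q : rat, `|x - ratr q| < e.
Proof.
move=> e0; have /rat_in_itvoo[q] : x - e < x + e by rewrite ltrD2l gtrN.
by rewrite in_itv /= => qe; exists q; rewrite distrC ltr_distl.
Qed.

(** Lower semicontinuity makes the strict hypograph open, and rational cubes form a base of the
    topology. *)
Lemma hypograph_cube x t : lower_semicontinuous f -> (t%:E < f x)%E ->
  exists2 p, below_graph p & in_cube p x t.
Proof.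
move=> lscf tf.
have [a ta af] : exists2 a, t < a & (a%:E < f x)%E.
  case: (f x) tf => [r| |//]; last by exists (t + 1); rewrite ?ltrDl// ltry.
  rewrite lte_fin => tr; exists ((t + r) / 2); first by rewrite midf_lt.
  by rewrite lte_fin midf_lt.
have [W /nbhs_ballP[e /= e0 eW] Wf] := lscf x a af.
(* Within [e] of [x] the values of [f] exceed [a], and within [a - t] of [t] the height stays below
   [a]. The cube radius is under half of the minimum, since two points are compared through the
   centre. *)
have d0 : 0 < Num.min e (a - t) by rewrite lt_min e0 subr_gt0.
have [m] : exists m, 0 + m.+1%:R^-1 < Num.min e (a - t) / 2.
  by apply: ltr_add_invr; rewrite divr_gt0.
rewrite add0r ltr_pdivlMr// => md.
have m0 : 0 < m.+1%:R :> R by rewrite ltr0n.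
have mV0 : 0 < m.+1%:R^-1 :> R by rewrite invr_gt0.
have small (y : R) : (`|m.+1%:R * y| < 1) = (`|y| < m.+1%:R^-1).
  by rewrite normrM gtr0_norm// -ltr_pdivlMl// mulr1.
have [s ts] := rat_approx t mV0.
have /choice[q xq] j := rat_approx (x 0 j) mV0.
exists (\row_j q j, s, m); rewrite /below_graph /in_cube /=; last first.
  by split=> [|j]; rewrite small// mxE.
move=> y u [us yq].
have twice (b c d : R) : `|b - c| < m.+1%:R^-1 -> `|d - c| < m.+1%:R^-1 ->
    `|b - d| < Num.min e (a - t).
  move=> bc dc; apply: le_lt_trans md; rewrite mulr_natr mulr2n.
  rewrite [X in `|X|](_ : _ = (b - c) - (d - c)); last by ring.
  by rewrite (le_trans (ler_normB _ _))// lerD// ltW.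
have : (a%:E < f y)%E.
  apply: Wf; apply: eW; split=> // i j; rewrite (ord1 i).
  have := yq j; rewrite small mxE => /(twice _ _ _ (xq j)).
  by rewrite lt_min => /andP[].
apply: lt_trans; rewrite lte_fin.
have : `|u - t| < Num.min e (a - t) by apply: twice ts; rewrite -small.
by rewrite lt_min => /andP[_ /ltr_normlW]; rewrite ltrD2r.
Qed.

(** The inverse radius of the cube numbered [i]. An index that codes no cube gets the default 0
    here, in [center] and in [weight], so its term vanishes. *)
Let scale (i : nat) : R := if unpickle i is Some p then (p : cube).2.+1%:R else 0.

Let center (i : nat) : V :=
  if unpickle i is Some p then (map_mx ratr (p : cube).1.1, const_mx (ratr p.1.2)) else 0.

(* The factor expR (- scale) absorbs every power of scale. *)
Let weight (i : nat) : R :=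
  if unpickle i is Some p then
    if `[< below_graph p >] then geometric 1 2^-1 i * expR (- scale i) else 0
  else 0.

Let scale_ge0 i : 0 <= scale i.
Proof. by rewrite /scale; case: unpickle. Qed.

Let weight_le i : 0 <= weight i <= geometric 1 2^-1 i * expR (- scale i).
Proof.
have H : 0 <= geometric 1 2^-1 i * expR (- scale i).
  by rewrite mulr_ge0 ?expR_ge0// geometric_ge0.
by rewrite /weight; case: unpickle => [p|]; rewrite ?lexx//; case: ifP; rewrite ?lexx ?H.
Qed.

(** Since $s^j e^{-s} \le j!$ for $s \ge 0$, the terms are dominated by $j!\,2^{-i}$. *)
Let cvg_weight j : cvgn (series (fun i => `|weight i| * `|scale i| ^+ j)).
Proof.
apply: (@series_le_cvg R _ ((j`!%:R : R) *: (geometric 1 2^-1 : R^nat))) => [i|i|i|].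
- by rewrite mulr_ge0// exprn_ge0.
- by rewrite mulr_ge0// geometric_ge0.
- have /andP[w0 wle] := weight_le i.
  rewrite !ger0_norm// (le_trans (ler_wpM2r _ wle)) ?exprn_ge0//.
  rewrite -mulrA [leRHS]mulrC ler_wpM2l ?geometric_ge0//.
  by rewrite expRN mulrC ler_pdivrMr ?expR_gt0// expr_le_expR.
- apply: is_cvg_seriesZ; apply: is_cvg_geometric_series.
  by rewrite ger0_norm// invf_lt1// ltr1n.
Qed.

Definition smooth_gap (z : V) : R :=
  limn (series (fun i => weight i * bump (scale i *: (z - center i)))).

Lemma Ck_smooth_gap k : Ck k smooth_gap.
Proof. by apply: Ck_rescaled_series => [j|]; [exact: BLk_bump|exact: cvg_weight]. Qed.

Let cvg_gap z : cvgn (series (fun i => weight i * bump (scale i *: (z - center i)))).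
Proof.
apply: (@cvg_rescaled_series _ _ bump weight scale center) => // k; exact: BLk_bump.
Qed.

Let term_ge0 z i : 0 <= weight i * bump (scale i *: (z - center i)).
Proof. by rewrite mulr_ge0 ?bump_ge0//; have /andP[] := weight_le i. Qed.

Lemma smooth_gap_ge0 z : 0 <= smooth_gap z.
Proof. by apply: limr_ge; [exact: cvg_gap|near=> i; exact: sumr_ge0].
Unshelve. all: by end_near. Qed.

Lemma smooth_gap_gt0 x (y : 'rV[R]_3) : lower_semicontinuous f ->
  0 < smooth_gap (x, y) <-> ((y 0 0)%:E < f x)%E.
Proof.
move=> lscf.
have bumpP p :
    0 < bump (p.2.+1%:R *: ((x, y) - (map_mx ratr p.1.1, const_mx (ratr p.1.2)) : V)) <->
    in_cube p x (y 0 0).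
  rewrite bump_gt0 /in_cube /= !mxE.
  by split=> -[? h]; split=> // j; have := h j; rewrite !mxE.
split=> [|/(hypograph_cube lscf)[p bp /bumpP px]].
  (* Outside the strict hypograph no admissible cube contains the point, so every term is zero. *)
  apply: contraPP => yf; rewrite /smooth_gap (_ : (fun i => _) = cst 0).
    rewrite (_ : series _ = cst 0) ?lim_cst ?ltxx//.
    by apply/funext => N; rewrite /series /= big1.
  apply/funext => i; apply/eqP; rewrite eq_le term_ge0 andbT leNgt; apply/negP.
  rewrite /weight /scale /center; case: unpickle => [p|]; last by rewrite mul0r ltxx.
  case: ifPn => [/asboolP bp|_]; last by rewrite mul0r ltxx.
  rewrite pmulr_rgt0; first by move=> /bumpP /bp.
  by rewrite mulr_gt0 ?expR_gt0//= mul1r exprn_gt0.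
(* All terms are nonnegative, so the limit is at least the partial sum that ends with the positive
   term of index [pickle p]. *)
apply: (@lt_le_trans _ _
  (series (fun i => weight i * bump (scale i *: ((x, y) - center i))) (pickle p).+1)).
  rewrite seriesSr; apply: ltr_wpDl; first exact: sumr_ge0.
  rewrite /weight /scale /center pickleK; case: asboolP => // _.
  apply: mulr_gt0 px; rewrite mulr_gt0 ?expR_gt0//= mul1r exprn_gt0//.
by apply: nondecreasing_cvgn_le; [exact: nondecreasing_series|exact: cvg_gap].
Qed.

Lemma smooth_gap_coord0 x (y y' : 'rV[R]_3) :
  y 0 0 = y' 0 0 -> smooth_gap (x, y) = smooth_gap (x, y').
Proof.
move=> yy; congr (limn (series _)); apply/funext => i; congr (_ * _).
rewrite /bump /coord1 /coord2 /=; congr (tent _ * _).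
by rewrite !mxE; congr (_ * (_ + _)).
Qed.

End Hypograph.

(** * The bilevel problem representing a lower semicontinuous function *)

Section OptimisticRepresentation.
Context {R : realType} {n : nat}.
Local Notation V := ('rV[R]_n * 'rV[R]_3)%type.
Variable f : 'rV[R]_n -> \bar R.
Hypotheses (f_NNy : forall x, f x != -oo%E) (f_lsc : lower_semicontinuous f).

Let i1 : 'I_3 := lift ord0 ord0.

Let upper (z : V) : R := coord2 (m := 2) ord0 z.
Let lower (z : V) : R := smooth_gap f z * expR (coord2 (m := 2) i1 z).

Let smooth_gap_eq0 x y : smooth_gap f (x, y) = 0 <-> (f x <= (y 0 0)%:E)%E.
Proof.
have [h1 h2] := smooth_gap_gt0 x y f_lsc; split=> [g0|]; rewrite leNgt.
  by apply/negP => /h2; rewrite g0 ltxx.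
move=> /negP nf; apply/eqP; rewrite eq_le smooth_gap_ge0 andbT leNgt.
by apply/negP => /h1.
Qed.

Let ThetaE x : Theta lower [set: 'rV[R]_3] x = [set y | (f x <= (y 0 0)%:E)%E].
Proof.
apply/seteqP; split=> y; rewrite /Theta /argmin /=; last first.
  move=> /smooth_gap_eq0 g0; split=> // z _.
  by rewrite /lower g0 mul0r mulr_ge0 ?expR_ge0 ?smooth_gap_ge0.
move=> [_ ymin]; apply/smooth_gap_eq0/eqP; rewrite eq_le smooth_gap_ge0 andbT.
rewrite leNgt; apply/negP => g0.
(* Lowering $y_1$ by 1 keeps the positive gap and shrinks the exponential, contradicting
   minimality. *)
have := ymin (y - delta_mx 0 i1) I.
rewrite /lower (@smooth_gap_coord0 _ _ f x _ y); last by rewrite !mxE subr0.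
rewrite ler_pM2l// ler_expR /coord2 /= !mxE !eqxx lerBrDl.
by rewrite gerDr leNgt ltr01.
Qed.

Lemma phi_opt_representation : exists P Q : V -> R,
  [/\ smooth P, smooth Q & forall x, phi_opt P Q [set: 'rV[R]_3] x = f x].
Proof.
exists upper, lower; split=> [k|k|x].
- by apply: (@Ck_linear _ _ k (@coord2 R n 2 ord0)); exact: coord2_continuous.
- apply: (@CkM _ _ k (smooth_gap f) (fun z => expR (coord2 (m := 2) i1 z))).
    exact: Ck_smooth_gap.
  by apply: (@Ck_expR _ _ k (@coord2 R n 2 i1)); exact: coord2_continuous.
rewrite /phi_opt ThetaE /upper /coord2 /=; apply/eqP; rewrite eq_le; apply/andP; split.
  (* A finite value [r] is attained by [P] at the constant row [r], which is a minimizer. *)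
  have := f_NNy x; case E : (f x) => [r| |] // _; last exact: leey.
  by apply: ereal_inf_lbound; exists (const_mx r); rewrite /= ?mxE.
(* Every minimizer satisfies $f(x) \le y_0$; for $f(x) = +\infty$ there is none, and the infimum is
   $+\infty$. *)
by apply: le_ereal_inf_tmp => _ [y yf <-].
Qed.

End OptimisticRepresentation.

(** * Both representations; the pessimistic one by a change of sign *)

Theorem theorem1p1 (R : realType) (n : nat) (n_gt0 : (1 <= n)%N) :
  (forall f : 'rV[R]_n -> \bar R,
     proper_above f -> lower_semicontinuous f -> closed (edom f) ->
     exists P Q : 'rV[R]_n * 'rV[R]_3 -> R,
       [/\ smooth P, smooth Q &
           forall x, phi_opt P Q [set: 'rV[R]_3] x = f x])
  /\
  (forall f : 'rV[R]_n -> \bar R,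
     proper_below f -> upper_semicontinuous f -> closed (edom f) ->
     exists P Q : 'rV[R]_n * 'rV[R]_3 -> R,
       [/\ smooth P, smooth Q &
           forall x, phi_pes P Q [set: 'rV[R]_3] x = f x]).
Proof.
split=> [f [fN _] lscf _|f [fN _] uscf _]; first exact: phi_opt_representation.
have [|x a|P [Q [sP sQ fPQ]]] := @phi_opt_representation R n (fun x => - f x)%E.
- by move=> x; rewrite eqe_oppLR.
- rewrite lteNr => /uscf[W xW Wf]; exists W => // y Wy.
  by rewrite lteNr; exact: Wf.
exists ((-1) *: P), Q; split=> // [k|x]; first exact: CkZ.
(* The minimizers depend on [Q] alone, so negating [P] turns the infimum for [-f] into minus a
   supremum over the same set. *)
rewrite /phi_pes -[RHS]oppeK -fPQ /phi_opt ereal_infEN oppeK image_comp.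
by congr ereal_sup; apply: eq_imagel => y _; rewrite /= scaleN1r.
Qed.
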